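(* Let $H$ and $K$ be groups satisfying at least one of the following properties: (i) both $H$ and $K$ satisfy both the maximal and the minimal condition on normal subgroups; (ii) $H$ and $K$ are abelian and one of them is of the form $D\oplus B\oplus F$, where $D$ is divisible, $B$ has finite exponent and $F$ is free abelian; (iii) one of $H$ and $K$ is a stem group. Then $\operatorname{Aut}(H\times K)\simeq\mathcal{A}_{H,K}$ if and only if $H$ and $K$ have no common non-trivial direct factor.
   Context: An endomorphism $\varphi$ of $H\times K$ is identified with the matrix $\begin{pmatrix}\alpha&\beta\\ \gamma&\delta\end{pmatrix}$, where $\alpha\in\operatorname{End}H$, $\beta\in\operatorname{Hom}(K,H)$, $\gamma\in\operatorname{Hom}(H,K)$, $\delta\in\operatorname{End}K$ and $\varphi(h,k)=(\alpha(h)\beta(k),\gamma(h)\delta(k))$. The set $\mathcal{A}_{H,K}$ consists of all such matrices with $\alpha\in\operatorname{Aut}H$, $\delta\in\operatorname{Aut}K$, $\beta\in\operatorname{Hom}(K,Z(H))$, $\gamma\in\operatorname{Hom}(H,Z(K))$. The notation $\operatorname{Aut}(H\times K)\simeq\mathcal{A}_{H,K}$ means that under this identification the set of automorphisms of $H\times K$ is exactly $\mathcal{A}_{H,K}$. A group $G$ is a stem group if $Z(G)\le G'$ (the derived subgroup). $H$ and $K$ have a common non-trivial direct factor if some non-trivial direct factor of $H$ is isomorphic to a direct factor of $K$. *)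

(* Defs.v *)
From HB Require Import structures.
From mathcomp Require Import all_boot ssralg ssrint.
From mathcomp Require Import boolp classical_sets functions.

Set Implicit Arguments.
Unset Strict Implicit.
Unset Printing Implicit Defensive.

Local Open Scope classical_set_scope.
Local Open Scope group_scope.

(* Groups are arbitrary (possibly infinite) [groupType]s, written              *)
(* multiplicatively, abelian ones included; subgroups are Prop-valued sets.    *)

Definition subgroup (G : groupType) (A : set G) : Prop :=
  [/\ A 1,
      forall x y : G, A x -> A y -> A (x * y) &
      forall x : G, A x -> A x^-1].

Definition normal_subgroup (G : groupType) (A : set G) : Prop :=
  subgroup A /\ (forall x g : G, A x -> A (x ^ g)).

Definition center (G : groupType) : set G :=
  [set z | forall x : G, commute z x].
Arguments center G : clear implicits.

Definition derived_subgroup (G : groupType) : set G :=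
  smallest (@subgroup G) [set z | exists x y : G, z = [~ x, y]].
Arguments derived_subgroup G : clear implicits.

Definition stem_group (G : groupType) : Prop :=
  center G `<=` derived_subgroup G.

Definition abelian_group (G : groupType) : Prop :=
  forall x y : G, commute x y.

Definition isomorphic (G L : groupType) : Prop :=
  exists f : {multiplicative G -> L}, bijective f.

(* The values of [f] outside [A] are irrelevant.                               *)
Definition isomorphic_subgroups (G L : groupType) (A : set G) (B : set L) :
    Prop :=
  exists f : G -> L,
    (forall x y : G, A x -> A y -> f (x * y) = f x * f y) /\ set_bij A B f.

Definition max_condition_normal (G : groupType) : Prop :=
  forall C : set (set G),
    C `<=` @normal_subgroup G -> C !=set0 ->
    exists2 N, C N & forall M, C M -> N `<=` M -> M = N.

Definition min_condition_normal (G : groupType) : Prop :=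
  forall C : set (set G),
    C `<=` @normal_subgroup G -> C !=set0 ->
    exists2 N, C N & forall M, C M -> M `<=` N -> M = N.

Definition divisible_group (G : groupType) : Prop :=
  abelian_group G /\
  forall (n : nat) (x : G), (0 < n)%N -> exists y : G, y ^+ n = x.

Definition finite_exponent (G : groupType) : Prop :=
  exists2 n : nat, (0 < n)%N & forall x : G, x ^+ n = 1.

Definition expgz (G : groupType) (x : G) (n : int) : G :=
  match n with
  | Posz m => x ^+ m
  | Negz m => x ^- m.+1
  end.

Definition abelian_basis (G : groupType) (X : set G) : Prop :=
  (forall g : G, exists (s : seq G) (e : G -> int),
     [set` s] `<=` X /\ g = \prod_(x <- s) expgz x (e x)) /\
  (forall (s : seq G) (e : G -> int),
     uniq s -> [set` s] `<=` X -> \prod_(x <- s) expgz x (e x) = 1 ->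
     forall x, x \in s -> e x = 0%R).

Definition free_abelian (G : groupType) : Prop :=
  abelian_group G /\ exists X : set G, abelian_basis X.

Definition divisible_bounded_free (G : groupType) : Prop :=
  exists D B F : groupType,
    [/\ divisible_group D,
        abelian_group B /\ finite_exponent B,
        free_abelian F &
        isomorphic G (D * B * F)%type].

Definition direct_factor (G : groupType) (A : set G) : Prop :=
  normal_subgroup A /\
  exists B : set G,
    [/\ normal_subgroup B,
        A `&` B = [set 1] &
        forall g : G, exists a b : G, [/\ A a, B b & g = a * b]].

Definition common_nontrivial_direct_factor (H K : groupType) : Prop :=
  exists (A : set H) (B : set K),
    [/\ direct_factor A, A <> [set 1],
        direct_factor B & isomorphic_subgroups A B].

Definition Aut (G : groupType) : set (G -> G) :=
  [set f | {morph f : x y / x * y} /\ bijective f].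
Arguments Aut G : clear implicits.

Record hom_matrix (H K : groupType) : Type := HomMatrix {
  hm_alpha : {multiplicative H -> H};
  hm_beta  : {multiplicative K -> H};
  hm_gamma : {multiplicative H -> K};
  hm_delta : {multiplicative K -> K}
}.

(* For an arbitrary matrix this map need not be an endomorphism: that requires *)
(* the images of the two entries of each row to commute elementwise.           *)
Definition hom_matrix_fun (H K : groupType) (M : hom_matrix H K) :
    H * K -> H * K :=
  fun x => (hm_alpha M x.1 * hm_beta M x.2, hm_gamma M x.1 * hm_delta M x.2).

Definition calA (H K : groupType) : set (hom_matrix H K) :=
  [set M | [/\ bijective (hm_alpha M), bijective (hm_delta M),
               range (hm_beta M) `<=` center H &
               range (hm_gamma M) `<=` center K]].
Arguments calA H K : clear implicits.

(* Equality of subsets of [H * K -> H * K], a matrix being identified with the *)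
(* map it defines; by [endo_hom_matrix] and [hom_matrix_fun_inj] this          *)
(* identification is one-to-one and covers all endomorphisms.                  *)
Definition Aut_prod_is_calA (H K : groupType) : Prop :=
  Aut (H * K)%type = [set hom_matrix_fun M | M in calA H K].

Lemma endo_hom_matrix (H K : groupType) (phi : H * K -> H * K) :
  {morph phi : x y / x * y} -> exists M : hom_matrix H K, phi = hom_matrix_fun M.
Proof.
move=> phiM.
have aM : {morph (fun h : H => (phi (h, 1)).1) : x y / x * y}.
  by move=> x y; rewrite -[1 in LHS]mulg1 (phiM (x, 1) (y, 1)).
have bM : {morph (fun k : K => (phi (1, k)).1) : x y / x * y}.
  by move=> x y; rewrite -[1 in LHS]mulg1 (phiM (1, x) (1, y)).
have cM : {morph (fun h : H => (phi (h, 1)).2) : x y / x * y}.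
  by move=> x y; rewrite -[1 in LHS]mulg1 (phiM (x, 1) (y, 1)).
have dM : {morph (fun k : K => (phi (1, k)).2) : x y / x * y}.
  by move=> x y; rewrite -[1 in LHS]mulg1 (phiM (1, x) (1, y)).
pose mk (G L : groupType) (f : G -> L) (fM : {morph f : x y / x * y}) :
    {multiplicative G -> L} :=
  HB.pack f (isMultiplicative.Build G L f fM).
exists (HomMatrix (mk _ _ _ aM) (mk _ _ _ bM) (mk _ _ _ cM) (mk _ _ _ dM)).
apply/funext => -[h k]; rewrite /hom_matrix_fun /=.
rewrite -[in LHS](mulg1 h) -[in LHS](mul1g k).
by rewrite (phiM (h, 1) (1, k)).
Qed.

Lemma hom_matrix_fun_inj (H K : groupType) (M N : hom_matrix H K) :
  hom_matrix_fun M = hom_matrix_fun N ->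
  [/\ hm_alpha M =1 hm_alpha N, hm_beta M =1 hm_beta N,
      hm_gamma M =1 hm_gamma N & hm_delta M =1 hm_delta N].
Proof.
have hom1 (G L : groupType) (f : {multiplicative G -> L}) : f 1 = 1.
  by apply: (@mulgI _ (f 1)); rewrite -gmulfM !mulg1.
move=> eqMN; split=> x.
- by have /(congr1 fst) := congr1 (@^~ (x, 1)) eqMN; rewrite /= !hom1 !mulg1.
- by have /(congr1 fst) := congr1 (@^~ (1, x)) eqMN; rewrite /= !hom1 !mul1g.
- by have /(congr1 snd) := congr1 (@^~ (x, 1)) eqMN; rewrite /= !hom1 !mulg1.
- by have /(congr1 snd) := congr1 (@^~ (1, x)) eqMN; rewrite /= !hom1 !mul1g.
Qed.

(* Main.v *)
From HB Require Import structures.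
Require Import Defs.
From mathcomp Require Import all_boot ssralg ssrnum ssrint intdiv.
From mathcomp Require Import boolp classical_sets functions.

(* Call endomorphisms [b \o c] of [H] and [c \o b] of [K], for homomorphisms   *)
(* [b : K -> H] and [c : H -> K], a pair of normal endomorphisms when both     *)
(* commute with inner automorphisms. Everything rests on [b \o c] being        *)
(* nilpotent for all such pairs when [H] and [K] have no common factor.        *)
(* If [phi] has matrix entries [alpha, beta], and its inverse has entries      *)
(* [alpha', gamma'] in its first column, then [alpha \o alpha'] is             *)
(* [1 - beta \o gamma'], which is bijective by nilpotency; conversely a matrix *)
(* of [calA] is invertible because [1 - alpha^-1 beta delta^-1 gamma] is.      *)
(*                                                                             *)
(* Nilpotency comes from Fitting's lemma: if the kernels and the images of the *)
(* powers of [f = b \o c] stabilise, then [H] is the product of a kernel and   *)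
(* an image of a power of [f], and [c] embeds the image as a direct factor of  *)
(* [K]. Chain conditions give stability at once; in a stem group [f ^ 2] is    *)
(* stable. In the abelian case an idempotent [b \o c] that is not zero already *)
(* yields a common factor. For [K] = D + B + F such idempotents are found in   *)
(* three ways: an injective hull of a cyclic subgroup for D, a pure cyclic     *)
(* subgroup for B, an infinite cyclic summand for F; without them [c \o b] is  *)
(* zero on D, raises heights in the socles of B, and [c] maps to 0 in F.       *)

(** [nilpotent_pairs] yields both inclusions between automorphisms and [calA], in
    [Aut_prod_sub_calA] and [calA_sub_Aut_prod]: if f is nilpotent, then 1 - f has trivial kernel
    and is inverted by a finite geometric series. The three hypotheses enter through
    [chain_conditions_nilpotent_pairs], [abelian_nilpotent_pairs] and [stem_nilpotent_pairs]. The
    abelian case rests on [graph_extension], which extends partial homomorphisms until an idempotent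
    [b \o c] appears.

    Conversely, suppose a factor A of H is isomorphic to a factor B of K. Exchanging A and B and
    fixing their complements is an automorphism of the product whose entry alpha kills A, so it lies
    outside [calA] ([Aut_prod_no_common_factor]). *)

Set Implicit Arguments.
Unset Strict Implicit.
Unset Printing Implicit Defensive.

Local Open Scope classical_set_scope.
Local Open Scope group_scope.

(** * Abelian groups *)

Section AdditiveGroups.
Import GRing.Theory.
Local Open Scope ring_scope.

(** * Subgroups and extension of partial homomorphisms *)

Section Subgroups.
Variable G : zmodType.

Definition zsubgroup (A : set G) : Prop :=
  A 0 /\ forall x y, A x -> A y -> A (x - y).

Variables (A : set G) (Asub : zsubgroup A).

Lemma zsubN x : A x -> A (- x).
Proof. by case: Asub => A0 AB Ax; rewrite -sub0r; apply: AB. Qed.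

Lemma zsubD x y : A x -> A y -> A (x + y).
Proof. by case: Asub => A0 AB Ax /zsubN Ay; rewrite -(opprK y); apply: AB. Qed.

Lemma zsubMn x n : A x -> A (x *+ n).
Proof.
move=> Ax; elim: n => [|n IHn]; first by rewrite mulr0n; case: Asub.
by rewrite mulrS; apply: zsubD.
Qed.

Lemma zsubMz x (k : int) : A x -> A (x *~ k).
Proof.
move=> Ax; case: k => n; first exact: zsubMn.
by rewrite NegzE mulrNz; apply/zsubN/zsubMn.
Qed.

(** The integers k with kx in [A] form an ideal; n is its non-negative generator, so 0 stands for
    infinite order modulo [A]. *)
Lemma order_mod x : exists n : nat, forall k : int, A (x *~ k) <-> (n %| k)%Z.
Proof.
have [[n0 [n0_gt0 An0]]|noA] :=
  pselect (exists n : nat, (0 < n)%N /\ A (x *+ n)).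
  have exn : exists n : nat, (0 < n)%N && `[< A (x *+ n) >].
    by exists n0; rewrite n0_gt0; apply/asboolP.
  case: (ex_minnP exn) => n /andP[n_gt0 /asboolP An] nmin.
  exists n => k; split=> [Ak|/dvdzP[q ->]]; last first.
    by rewrite mulrC mulrzA; apply: zsubMz.
  have Ar : A (x *~ (k %% n)%Z).
    rewrite /modz mulrzBr mulrC mulrzA; apply: (proj2 Asub) => //.
    exact: zsubMz.
  have nz : n%:Z != 0 by rewrite eqz_nat -lt0n.
  apply/dvdz_mod0P.
  have rge := modz_ge0 k nz; have rlt := ltz_pmod k (n_gt0 : (0 < n%:Z)%R).
  case: (k %% n)%Z Ar rge rlt => // r Ar _ rlt.
  have [-> //|r_gt0] := posnP r.
  have /nmin : (0 < r)%N && `[< A (x *+ r) >] by rewrite r_gt0; apply/asboolP.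
  by rewrite leqNgt -ltz_nat rlt.
exists 0%N => k; rewrite dvd0z; split=> [|/eqP ->]; last by rewrite mulr0z; case: Asub.
case: k => [[//|n]|n] Ak; case: noA; exists n.+1; split=> //.
by rewrite -(opprK (x *+ n.+1)); apply: zsubN; rewrite -[x *+ _]/(x *~ n.+1) -mulrNz -NegzE.
Qed.

End Subgroups.

(** Zorn's lemma runs over the sets whose union with [A0] is a subgroup avoiding [T], so that the
    empty chain is harmless. Were no m + kg in [T], adjoining g to the maximal subgroup would
    enlarge it. *)
Lemma zorn_avoid (G : zmodType) (A0 T : set G) :
  zsubgroup A0 -> (forall x, A0 x -> ~ T x) ->
  exists M : set G,
    [/\ zsubgroup M, A0 `<=` M, forall x, M x -> ~ T x &
        forall g, ~ M g -> exists m (k : int), M m /\ T (m + g *~ k)].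
Proof.
move=> A0sub A0T.
pose P (B : set G) := zsubgroup (A0 `|` B) /\ forall x, (A0 `|` B) x -> ~ T x.
have [F FP Ftot|M [[Msub MT] Mmax]] := @Zorn_bigcup G P.
  have [[B0 FB0]|F0] := pselect (F !=set0); last first.
    have -> : \bigcup_(X in F) X = set0.
      by rewrite eqEsubset; split=> // x [B FB]; case: F0; exists B.
    by rewrite /P setU0.
  split; last first.
    move=> x [A0x|[B FB Bx]]; first exact: A0T.
    by have [_] := FP _ FB; apply; right.
  split=> [|x y]; first by left; case: A0sub.
  have up B z : F B -> (A0 `|` B) z -> (A0 `|` \bigcup_(X in F) X) z.
    by move=> FB [A0x|Bx]; [left|right; exists B].
  have inF z : (A0 `|` \bigcup_(X in F) X) z -> exists2 B, F B & (A0 `|` B) z.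
    by move=> [A0x|[B FB Bx]]; [exists B0 => //; left|exists B => //; right].
  move=> /inF[B FB Bx] /inF[C FC Cy].
  have [BC|CB] := Ftot _ _ FB FC.
    apply: (up C) => //; apply: (proj2 (proj1 (FP _ FC))) => //.
    by case: Bx => [|/BC]; [left|right].
  apply: (up B) => //; apply: (proj2 (proj1 (FP _ FB))) => //.
  by case: Cy => [|/CB]; [left|right].
exists (A0 `|` M); split=> // g Mg; apply: contrapT => noT.
pose N := [set x | exists m (k : int), (A0 `|` M) m /\ x = m + g *~ k].
apply: (Mmax N).
  split=> [x Mx|NM]; first by exists x, 0; rewrite mulr0z addr0; split; [right|].
  by apply: Mg; right; apply: NM; exists 0, 1; rewrite add0r; split=> //; case: Msub.
have NE : A0 `|` N = N.
  apply: setUidr => x A0x; exists x, 0; rewrite mulr0z addr0.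
  by split; [left|].
rewrite /P NE; split; first split.
- by exists 0, 0; rewrite mulr0z addr0; split=> //; case: Msub.
- move=> _ _ [m1 [k1 [M1 ->]]] [m2 [k2 [M2 ->]]].
  exists (m1 - m2), (k1 - k2); split; first by apply: (proj2 Msub).
  by rewrite mulrzBr opprD addrACA.
- by move=> _ [m [k [Mm ->]]] Tx; apply: noT; exists m, k.
Qed.

Lemma pairMz (U V : zmodType) (u : U) (v : V) (k : int) :
  (u, v) *~ k = (u *~ k, v *~ k).
Proof.
by apply/eqP; rewrite -pair_eqE /= (raddfMz fst) (raddfMz snd) !eqxx.
Qed.

Definition pack_additive (G E : zmodType) (f : G -> E)
    (fB : {morph f : x y / x - y}) : {additive G -> E} :=
  HB.pack f (GRing.isZmodMorphism.Build G E f fB).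

(** The graph of a homomorphism from a subgroup of [G], with values in [S]. *)
Definition functional (G E : zmodType) (S : set E) (R : set (G * E)) : Prop :=
  [/\ zsubgroup R, forall d, R (0, d) -> d = 0 & forall u, R u -> S u.2].

(** A maximal graph is total, since otherwise (g, d) could be adjoined: if kg is in the domain, then
    n divides k and k(g, d) is already in the graph. The element g need not be the missing [g1]. *)
Lemma graph_extension (G E : zmodType) (S : set E) (R0 : set (G * E)) :
  zsubgroup S -> functional S R0 ->
  (forall R g1, functional S R -> R0 `<=` R -> ~ (exists d, R (g1, d)) ->
     exists g (n : nat) d, [/\ ~ (exists e, R (g, e)), S d,
       forall (k : int) e, R (g *~ k, e) -> (n %| k)%Z & R (g *+ n, d *+ n)]) ->
  exists f : {additive G -> E},
    (forall g d, R0 (g, d) -> f g = d) /\ forall g, S (f g).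
Proof.
move=> Ssub [R0sub R0f R0S] step.
pose T : set (G * E) := [set u | ~ S u.2 \/ (u.1 = 0 /\ u.2 <> 0)].
have [u R0u [|[u1 u2]]|M [Msub R0M MT Mmax]] := zorn_avoid (T := T) R0sub.
- by apply; exact: R0S.
- by apply: u2; apply: R0f; rewrite -u1 -surjective_pairing.
have Mf d : M (0, d) -> d = 0.
  by move=> M0d; apply: contrapT => d0; apply: (MT _ M0d); right.
have MS u : M u -> S u.2.
  by move=> Mu; apply: contrapT => Su; apply: (MT _ Mu); left.
have Mtot g1 : exists d, M (g1, d).
  apply: contrapT => g1M.
  have [|g [n [d [gM Sd dvd Mgd]]]] := step M g1 _ R0M g1M; first by [].
  have [|m [k [Mm Tm]]] := Mmax (g, d); first by move=> Mg; apply: gM; exists d.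
  have Su : S (m + (g, d) *~ k).2.
    by rewrite pairMz; apply: zsubD => //; [exact: MS|exact: zsubMz].
  case: Tm => [|[u1 u2]]; first by apply.
  have : M (g *~ - k, m.2).
    rewrite mulrNz -(addr0 (- (g *~ k))) -u1 pairMz /= addrCA addNr addr0.
    by rewrite -surjective_pairing.
  move=> /dvd/dvdzP[q ekN].
  have ek : k = - q * n by rewrite mulNr -ekN opprK.
  apply: u2; apply: Mf; rewrite -u1 -surjective_pairing.
  apply: zsubD => //; rewrite ek mulrC mulrzA; apply: zsubMz => //.
  by rewrite pairMz.
have /choice[f fP] := Mtot.
have Muniq g d e : M (g, d) -> M (g, e) -> d = e.
  move=> Md Me; apply/eqP; rewrite -subr_eq0; apply/eqP/Mf.
  by rewrite -(subrr g); apply: (proj2 Msub _ _ Md Me).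
have fB : {morph f : x y / x - y}.
  by move=> x y; apply: (Muniq (x - y)) => //; apply: (proj2 Msub _ _ (fP x) (fP y)).
exists (pack_additive fB); split=> [g d R0g|g].
  by apply: (Muniq g) => //=; apply: R0M.
exact: (MS (g, f g)).
Qed.

(** * Divisible groups *)

Definition zdivisible (G : zmodType) (S : set G) : Prop :=
  forall (n : nat) x, (0 < n)%N -> S x -> exists2 y, S y & y *+ n = x.

(** Baer's argument that divisible groups are injective: if n is the order of g modulo the domain, g
    is sent to an n-th part of the value at ng, or to 0 when n = 0. *)
Lemma divisible_extension (G E : zmodType) (S : set E) (R0 : set (G * E)) :
  zsubgroup S -> zdivisible S -> functional S R0 ->
  exists f : {additive G -> E},
    (forall g d, R0 (g, d) -> f g = d) /\ forall g, S (f g).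
Proof.
move=> Ssub Sdiv R0f; apply: graph_extension => // R g [Rsub Rf RS] R0R gR.
pose dom := [set x | exists e, R (x, e)].
have domsub : zsubgroup dom.
  split=> [|x y [d Rd] [e Re]]; first by exists 0; case: Rsub.
  by exists (d - e); apply: (proj2 Rsub _ _ Rd Re).
have [n nP] := order_mod domsub g.
have [e Re] : dom (g *~ n) by apply/nP.
have [n0|n_gt0] := posnP n.
  exists g, n, 0; split=> //; first by case: Ssub.
    by move=> k d Rk; apply/nP; exists d.
  by rewrite n0; case: Rsub.
have [d Sd de] := Sdiv n e n_gt0 (RS _ Re).
exists g, n, d; split=> //; last by rewrite de.
by move=> k d' Rk; apply/nP; exists d'.
Qed.

(** The image of an idempotent [b \o c] is a summand of [H] that [c] embeds as a summand of [K]. *)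
Definition no_common_idempotent (H K : zmodType) : Prop :=
  forall (b : {additive K -> H}) (c : {additive H -> K}),
    (forall x, b (c (b (c x))) = b (c x)) -> forall x, b (c x) = 0.

(* A maximal subgroup [C] avoiding the nonzero multiples of [y] is divisible; *)
(* the kernel of a retraction onto [C] killing [y] is an injective hull       *)
(* of [y].                                                                    *)
Lemma divisible_hull (D : zmodType) (y : D) :
  zdivisible [set: D] ->
  exists S : set D,
    [/\ zsubgroup S, zdivisible S, S y &
        forall s, S s -> s <> 0 -> exists k m : int, s *~ k = y *~ m /\ y *~ m <> 0].
Proof.
move=> Ddiv.
pose T := [set x | x <> 0 /\ exists m : int, x = y *~ m].
have sub0 : zsubgroup [set 0 : D] by split=> // _ _ -> ->; rewrite subr0.
have [_ -> []//|C [Csub _ CT Cmax]] := zorn_avoid (T := T) sub0.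
have Cy m : C (y *~ m) -> y *~ m = 0.
  by move=> Cm; apply: contrapT => m0; apply: (CT _ Cm); split=> //; exists m.
have C0 : C 0 by case: Csub.
have Cdiv : zdivisible C.
  (* Take x with nx = c, of order j modulo C + <y>. If j < n, then c = (n/j)c1 and induction divides
     c1 by j. If j = n, then x is in [C]: by maximality some c2 + kx would otherwise be a nonzero
     multiple of y, yet j divides k and jx = c puts it in [C]. *)
  elim/ltn_ind => n IHn c n_gt0 Cc.
  pose Cplus := [set x | exists c1 (m : int), C c1 /\ x = c1 + y *~ m].
  have Cplus_sub : zsubgroup Cplus.
    split=> [|_ _ [c1 [m1 [Cc1 ->]]] [c2 [m2 [Cc2 ->]]]].
      by exists 0, 0; rewrite mulr0z addr0.
    exists (c1 - c2), (m1 - m2); split; first exact: (proj2 Csub).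
    by rewrite mulrzBr opprD addrACA.
  have [x _ xn] := Ddiv n c n_gt0 I.
  have [j jP] := order_mod Cplus_sub x.
  have : (j %| n%:Z)%Z.
    by apply/jP; exists c, 0; split; rewrite // mulr0z addr0 -xn.
  rewrite dvdzE !absz_nat => /dvdnP[q nE].
  have [c1 [m [Cc1 jx]]] : Cplus (x *~ j) by apply/jP.
  have [j_gt0 q_gt0] : (0 < j)%N /\ (0 < q)%N.
    by move: n_gt0; rewrite nE muln_gt0 => /andP[].
  have cE : c = c1 *+ q.
    have e : c - c1 *+ q = y *~ (m * q).
      by rewrite -xn nE mulnC mulrnA -[x *+ j]/(x *~ j) jx mulrnDl addrC addKr mulrzA.
    have /Cy ym0 : C (y *~ (m * q)).
      by rewrite -e; apply: (proj2 Csub) => //; apply: zsubMn.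
    by apply/eqP; rewrite -subr_eq0 e ym0.
  have [jn|jn] := ltnP j n.
    have [c2 Cc2 c2j] := IHn j jn c1 j_gt0 Cc1.
    by exists c2; rewrite // nE mulnC mulrnA c2j cE.
  have qE : q = 1%N.
    by move: jn; rewrite nE -{2}[j]mul1n leq_pmul2r // => q1; apply/eqP; rewrite eqn_leq q1.
  have [Cx|Cx] := pselect (C x); first by exists x.
  have [c2 [k [Cc2 [T0 [m' Tm]]]]] := Cmax x Cx.
  have : (j %| k)%Z.
    apply/jP; exists (- c2), m'; split; first exact: zsubN.
    by rewrite -Tm addKr.
  move=> /dvdzP[r kE]; case: T0; rewrite Tm; apply: Cy; rewrite -Tm.
  apply: zsubD => //; rewrite kE mulrC mulrzA; apply: zsubMz => //.
  by rewrite -[x *~ j]/(x *+ j) -[j]mul1n -qE -nE xn.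
pose R0 : set (D * D) := [set u | C u.2 /\ exists m : int, u.1 = u.2 + y *~ m].
have [|rho [rhoR rhoC]] := @divisible_extension D D C R0 Csub Cdiv.
  split; last by move=> u [].
    split; first by split=> //; exists 0; rewrite mulr0z addr0.
    move=> [x1 x2] [y1 y2] [/= Cx2 [mx ->]] [/= Cy2 [my ->]]; split.
      exact: (proj2 Csub).
    by exists (mx - my); rewrite /= mulrzBr opprD addrACA.
  move=> d [/= Cd [m dm]].
  have dE : d = - (y *~ m) by apply/eqP; rewrite -addr_eq0 -dm.
  have /Cy : C (y *~ m) by rewrite -[y *~ m]opprK -dE; apply: zsubN.
  by rewrite dE => ->; rewrite oppr0.
have rho_id c : C c -> rho c = c.
  by move=> Cc; apply: rhoR; split=> //=; exists 0; rewrite mulr0z addr0.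
have rho_y : rho y = 0.
  by apply: rhoR; split=> //=; exists 1; rewrite add0r mulr1z.
exists [set s | rho s = 0]; split=> //.
- by split=> [|x z /=]; rewrite /= ?raddf0 // raddfB => -> ->; rewrite subr0.
- move=> n s n_gt0 /= s0; have [t _ ts] := Ddiv n s n_gt0 I.
  exists (t - rho t); first by rewrite /= raddfB (rho_id (rho t)) ?subrr.
  by rewrite mulrnBl ts -raddfMn ts s0 subr0.
- move=> s /= rs s0.
  have Cs : ~ C s by move=> /rho_id; rewrite rs => /esym.
  have [c [k [Cc [T0 [m Tm]]]]] := Cmax s Cs; rewrite Tm in T0.
  have c0 : c = 0.
    have := congr1 rho Tm.
    by rewrite raddfD (raddfMz rho) rs mul0rz addr0 (raddfMz rho) rho_y mul0rz rho_id.
  by exists k, m; rewrite -Tm c0 add0r in T0 *.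
Qed.

(** If [b] were injective on <y>, it would be injective on the hull S of y. The inverse on b(S)
    extends to c : H -> S, and [b \o c] is an idempotent fixing b(y). *)
Lemma divisible_embedding (D H : zmodType) (y : D) (b : {additive D -> H}) :
  zdivisible [set: D] -> no_common_idempotent H D -> y <> 0 ->
  ~ (forall k : int, b (y *~ k) = 0 -> y *~ k = 0).
Proof.
move=> Ddiv NC y0 by_inj.
have [S [Ssub Sdiv Sy Sess]] := divisible_hull y Ddiv.
have S0 : S 0 by case: Ssub.
have bS s : S s -> b s = 0 -> s = 0.
  move=> Ss bs; apply: contrapT => s0.
  have [k [m [skm ym0]]] := Sess s Ss s0; apply: ym0; apply: by_inj.
  by rewrite -skm (raddfMz b) bs mul0rz.
pose R0 : set (H * D) := [set u | S u.2 /\ u.1 = b u.2].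
have [|c [cR cS]] := @divisible_extension H D S R0 Ssub Sdiv.
  split; last by move=> u [].
    split; first by split; rewrite /= ?raddf0.
    move=> [x1 x2] [z1 z2] [/= Sx ->] [/= Sz ->]; split; last by rewrite /= raddfB.
    exact: (proj2 Ssub).
  by move=> d [/= Sd /esym]; apply: bS.
have cb s : S s -> c (b s) = s by move=> Ss; apply: cR.
have := NC b c (fun x => congr1 b (cb _ (cS x))) (b y).
by rewrite cb // => /bS-/(_ Sy).
Qed.

(** A nonzero y = c(b(d)) contradicts [divisible_embedding]: with [b] itself if b(d) has infinite
    order, otherwise with a map from [D] to the divisible group b(D) that is injective on <y>. *)
Lemma divisible_pair_zero (D H : zmodType) (b : {additive D -> H})
    (c : {additive H -> D}) :
  zdivisible [set: D] -> no_common_idempotent H D -> forall d, c (b d) = 0.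
Proof.
move=> Ddiv NC d; apply: contrapT; set y := c (b d) => y0.
have sub0 (G : zmodType) : zsubgroup [set 0 : G] by split=> // _ _ -> ->; rewrite subr0.
have [n nP] := order_mod (sub0 D) y; have [N NP] := order_mod (sub0 H) (b d).
have [N0|N_gt0] := posnP N.
  have d0 : d <> 0 by move=> d0; apply: y0; rewrite /y d0 !raddf0.
  apply: (divisible_embedding (b := b) Ddiv NC d0) => k.
  by rewrite (raddfMz b) => /NP; rewrite N0 dvd0z => /eqP ->; rewrite mulr0z.
have : (n %| N%:Z)%Z.
  apply/nP; rewrite /= -(raddfMz c); have -> : b d *~ N = 0 by apply/NP.
  exact: raddf0.
rewrite dvdzE !absz_nat => /dvdnP[m NE].
have m_gt0 : (0 < m)%N by move: N_gt0; rewrite NE muln_gt0 => /andP[].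
(* This multiple of b(d) has the same order n as y. *)
pose h := b d *+ m.
have hP k : y *~ k = 0 <-> h *~ k = 0.
  split=> [/nP nk|hk].
    rewrite /h -[b d *+ m]/(b d *~ m) -mulrzA; apply/NP.
    by rewrite NE PoszM; apply: dvdz_mul.
  apply/nP; have : (N %| m%:Z * k)%Z.
    by apply/NP; rewrite /= mulrzA.
  by rewrite NE PoszM dvdz_mul2l //; rewrite eqz_nat -lt0n.
pose R0 : set (D * H) := [set u | exists k : int, u = (y *~ k, h *~ k)].
have Esub : zsubgroup (range b).
  split=> [|_ _ [u _ <-] [v _ <-]]; first by exists 0; rewrite ?raddf0.
  by exists (u - v); rewrite ?raddfB.
have Ediv : zdivisible (range b).
  move=> j _ j_gt0 [u _ <-]; have [v _ vu] := Ddiv j u j_gt0 I.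
  by exists (b v); [exists v|rewrite -raddfMn vu].
have [|f [fR _]] := divisible_extension (R0 := R0) Esub Ediv.
  split.
  - split=> [|_ _ [k1 ->] [k2 ->]]; first by exists 0; rewrite !mulr0z.
    by exists (k1 - k2); rewrite !mulrzBr.
  - by move=> e [k [yk ->]]; apply/hP.
  - move=> _ [k ->]; apply: (zsubMz Esub).
    by exists (d *+ m); rewrite ?raddfMn.
apply: (divisible_embedding (b := f) Ddiv NC y0) => k.
by rewrite (fR _ (h *~ k)) => [/hP|]; last by exists k.
Qed.

(** * Groups of finite exponent *)

Lemma iter_add0 (G : zmodType) (f : {additive G -> G}) n : iter n f 0 = 0.
Proof. by elim: n => //= n ->; rewrite raddf0. Qed.

(** The order of x modulo [A] divides p, so it is 1 or p; it also divides k, so it is not p. *)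
Lemma zsubgroup_prime_multiple (G : zmodType) (A : set G) (x : G) p (k : int) :
  zsubgroup A -> prime p -> A (x *+ p) -> A (x *~ k) -> ~~ (p %| k)%Z -> A x.
Proof.
move=> Asub pp Ap Ak pk; have [n nP] := order_mod Asub x.
have np : (n %| p%:Z)%Z by apply/nP.
have nk : (n %| k)%Z by apply/nP.
have /orP[/eqP n1|/eqP eqnp] : (n == 1%N) || (n == p).
  by have [_] := primeP pp; apply; rewrite dvdzE !absz_nat in np.
- by rewrite -[x]mulr1z; apply/nP; rewrite n1 dvd1z.
- by rewrite -eqnp nk in pk.
Qed.

(* The hypotheses on [y] make its cyclic subgroup pure, hence a direct summand. *)
Lemma pure_cyclic_retract (H B : zmodType) p i (y : H) (z : B) :
  prime p -> y *+ (p ^ i.+1) = 0 -> (forall h, h *+ (p ^ i.+1) <> y *+ (p ^ i)) ->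
  z *+ (p ^ i.+1) = 0 -> z *+ (p ^ i) <> 0 ->
  exists c : {additive H -> B}, c y = z /\ forall h, exists k : int, c h = z *~ k.
Proof.
move=> pp y0 ypure z0 z1.
pose S := [set x | exists k : int, x = z *~ k].
(* The partial map sends ky + p^(i+1)h to kz; [ydvd] makes it single-valued. *)
pose R0 : set (H * B) := [set u | exists (k : int) h, u = (y *~ k + h *+ p ^ i.+1, z *~ k)].
have Ssub : zsubgroup S.
  split=> [|_ _ [k ->] [l ->]]; first by exists 0; rewrite mulr0z.
  by exists (k - l); rewrite mulrzBr.
pose P := [set x | exists h : H, x = h *+ p ^ i.+1].
have Psub : zsubgroup P.
  split=> [|_ _ [h ->] [g ->]]; first by exists 0; rewrite mul0rn.
  by exists (h - g); rewrite mulrnBl.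
have ydvd k : P (y *~ k) -> ((p ^ i.+1)%N%:Z %| k)%Z.
  have [n nP] := order_mod Psub y.
  have : (n %| (p ^ i.+1)%N%:Z)%Z.
    by apply/nP; exists 0; rewrite mul0rn -[LHS]/(y *+ p ^ i.+1).
  rewrite dvdzE !absz_nat => /(dvdn_pfactor _ _ pp)[j ji nE].
  move=> /nP; suff -> : n = (p ^ i.+1)%N by [].
  rewrite nE; congr (p ^ _)%N; apply/eqP; rewrite eqn_leq ji ltnNge /=.
  apply/negP => ji'.
  have [h hE] : P (y *~ (p ^ i)%N) by apply/nP; rewrite dvdzE !absz_nat nE dvdn_exp2l.
  by apply: (ypure h).
have zdvd k : ((p ^ i.+1)%N%:Z %| k)%Z -> z *~ k = 0.
  by move=> /dvdzP[q ->]; rewrite mulrC mulrzA -[z *~ _]/(z *+ _) z0 mul0rz.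
have [||c [cR cS]] := @graph_extension H B S R0 Ssub.
- split.
  + split=> [|_ _ [k [h ->]] [l [g ->]]].
      by exists 0, 0; rewrite !mulr0z mul0rn addr0.
    exists (k - l), (h - g); rewrite !mulrzBr mulrnBl; congr (_, _) => /=.
    by rewrite opprD addrACA.
  + move=> d [k [h [e ->]]]; apply/zdvd/ydvd; exists (- h).
    by apply/eqP; rewrite mulNrn -addr_eq0 -e.
  + by move=> _ [k [h ->]]; exists k.
- move=> R g1 [Rsub Rf RS] R0R g1R.
  pose dom := [set x | exists e, R (x, e)].
  have domsub : zsubgroup dom.
    split=> [|x w [d Rd] [e Re]]; first by exists 0; case: Rsub.
    by exists (d - e); apply: (proj2 Rsub _ _ Rd Re).
  have exj : exists j, `[< dom (g1 *+ p ^ j) >].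
    exists i.+1; apply/asboolP; exists 0; apply: R0R; exists 0, g1.
    by rewrite !mulr0z add0r.
  case: (ex_minnP exj) => -[|j] /asboolP; first by rewrite mulr1n.
  (* By minimality g is outside the domain while pg is inside. *)
  move=> domj jmin; pose g := g1 *+ p ^ j.
  have gdom : ~ dom g by move=> /asboolP/jmin; rewrite ltnn.
  have [e Re] : dom (g *+ p) by rewrite -mulrnA mulnC -expnS.
  have [m eE] := RS _ Re; rewrite /= in eE.
  (* The graph vanishes on p^(i+1)H, so p^i e = 0. As p^i z is nonzero, p divides m, and e can be
     divided by p inside <z>. *)
  have pm : (p %| m)%Z.
    apply: contrapT => /negP pm; apply: z1.
    apply: (@zsubgroup_prime_multiple B [set 0] (z *+ p ^ i) p m) => //.
    - by split=> // _ _ -> ->; rewrite subr0.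
    - by rewrite /= -mulrnA mulnC -expnS.
    rewrite /= -[z *+ p ^ i]/(z *~ (p ^ i)%N) -mulrzA mulrC mulrzA -eE.
    apply: Rf; rewrite -(subrr (g *+ p ^ i.+1)) -[X in R (_, X)]subr0.
    have R1 : R (g *+ p ^ i.+1, e *+ p ^ i).
      have := zsubMz Rsub (p ^ i)%N%:Z Re.
      by rewrite pairMz -[_ *~ _]/(g *+ p *+ p ^ i) -mulrnA -expnS.
    have R2 : R (g *+ p ^ i.+1, 0).
      by apply: R0R; exists 0, g; rewrite !mulr0z add0r.
    exact: (proj2 Rsub _ _ R1 R2).
  have [q mE] := dvdzP pm.
  exists g, p, (z *~ q); split=> //; first by exists q.
    move=> k d Rk; apply: contrapT => /negP pk; apply: gdom.
    by apply: (zsubgroup_prime_multiple domsub pp _ _ pk); [exists e|exists d].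
  by rewrite -[z *~ q *+ p]/(z *~ q *~ p) -mulrzA -mE -eE.
exists c; split; last exact: cS.
by apply: cR; exists 1, 0; rewrite mul0rn addr0 !mulr1z.
Qed.

(** On elements killed by a prime p, [c \o b] raises p-heights, and heights are bounded; other
    elements are treated by stripping primes off their annihilator. *)
Lemma bounded_nilpotent (B H : zmodType) (N : nat) (b : {additive B -> H})
    (c : {additive H -> B}) :
  (0 < N)%N -> (forall x : B, x *+ N = 0) -> no_common_idempotent H B ->
  exists n, forall x, iter n (c \o b) x = 0.
Proof.
move=> N_gt0 BN NC; pose g : {additive B -> B} := c \o b.
have step p i (x : B) : prime p -> x *+ p = 0 ->
    (exists z, x = z *+ p ^ i) -> exists z, g x = z *+ p ^ i.+1.
  (* Otherwise b(z) generates a pure cyclic subgroup; the map f sending b(z) to z makes [b \o f]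
     idempotent, hence zero, so b(z) = 0. *)
  move=> pp xp [z xz]; apply: contrapT => gx.
  have [|h|||f [fy fz]] := @pure_cyclic_retract H B p i (b z) z pp.
  - by rewrite expnSr mulrnA -!(raddfMn b) -xz xp raddf0.
  - by rewrite -(raddfMn b) -xz => hE; apply: gx; exists (c h); rewrite /= -hE raddfMn.
  - by rewrite expnSr mulrnA -xz xp.
  - by rewrite -xz => x0; apply: gx; exists 0; rewrite x0 raddf0 mul0rn.
  have bf w : b (f (b (f w))) = b (f w).
    by have [k ->] := fz w; rewrite (raddfMz b) (raddfMz f) fy (raddfMz b).
  have bz0 : b z = 0 by have := NC b f bf (b z); rewrite fy.
  by apply: gx; exists 0; rewrite mul0rn xz raddfMn /= bz0 raddf0 mul0rn.
have stepn p n (x : B) : prime p -> x *+ p = 0 ->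
    iter n g x *+ p = 0 /\ exists z, iter n g x = z *+ p ^ n.
  move=> pp xp; elim: n => [|n [IHp IHz]]; first by split=> //; exists x; rewrite mulr1n.
  by split; [rewrite /= -!raddfMn IHp !raddf0|apply: step pp IHp IHz].
have gNp p (x : B) : prime p -> x *+ p = 0 -> iter N g x = 0.
  move=> pp xp; have [px [z gz]] := stepn p N x pp xp.
  have z0 : zsubgroup [set 0 : B] by split=> // _ _ -> ->; rewrite subr0.
  rewrite -[_ = 0]/([set 0 : B] _).
  apply: (@zsubgroup_prime_multiple B [set 0] _ p (N`_p^')%N z0 pp px).
    rewrite /= gz -[_ *~ _]/(z *+ p ^ N *+ (N`_p^')%N) -mulrnA.
    have : (N %| p ^ N * N`_p^')%N.
      rewrite -{1}(partnC p N_gt0) dvdn_pmul2r ?part_gt0 //.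
      by rewrite p_part dvdn_exp2l // ltnW // ltn_logl.
    by move=> /dvdnP[q ->]; rewrite mulnC mulrnA BN mul0rn.
  by rewrite dvdzE !absz_nat -p'natE // part_pnat.
have gm m : (0 < m)%N -> forall x, x *+ m = 0 -> iter (m * N) g x = 0.
  elim/ltn_ind: m => m IHm m_gt0 x xm.
  have [m1|m_gt1] := leqP m 1.
    have mE : m = 1%N by apply/eqP; rewrite eqn_leq m1.
    by rewrite -[x]mulr1n -mE xm iter_add0.
  have pp := pdiv_prime m_gt1; set p := pdiv m in pp.
  have [m' mE] := dvdnP (pdiv_dvd m); rewrite -/p in mE.
  have m'_gt0 : (0 < m')%N by move: m_gt0; rewrite mE muln_gt0 => /andP[].
  have m'm : (m' < m)%N by rewrite mE ltn_Pmulr // prime_gt1.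
  have gxm' : iter N g x *+ m' = 0.
    have -> : iter N g x *+ m' = iter N g (x *+ m').
      by elim: (N) => //= n <-; rewrite !raddfMn.
    by apply: (gNp p) => //; rewrite -mulrnA -mE.
  have := IHm _ m'm m'_gt0 _ gxm'; rewrite -iterD => gx.
  have le : (m' * N + N <= m * N)%N by rewrite addnC -mulSn leq_mul2r m'm orbT.
  by rewrite -(subnK le) iterD gx iter_add0.
by exists (N * N)%N => x; apply: gm.
Qed.

(** * Free abelian groups *)

Definition zbasis (F : zmodType) (X : set F) : Prop :=
  (forall g : F, exists (s : seq F) (e : F -> int),
     [set` s] `<=` X /\ g = \sum_(x <- s) x *~ e x) /\
  (forall (s : seq F) (e : F -> int),
     uniq s -> [set` s] `<=` X -> \sum_(x <- s) x *~ e x = 0 ->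
     forall x, x \in s -> e x = 0).

(** The list only has to contain the support of [a], so two elements can share one list. *)
Definition coordinates (F : zmodType) (X : set F) (g : F) (a : F -> int) : Prop :=
  exists s : seq F, [/\ uniq s, [set` s] `<=` X, forall x, x \notin s -> a x = 0 &
    g = \sum_(x <- s) x *~ a x].

Lemma sum_widen (F : zmodType) (s t : seq F) (a : F -> int) :
  uniq s -> uniq t -> {subset s <= t} -> (forall x, x \notin s -> a x = 0) ->
  \sum_(x <- t) x *~ a x = \sum_(x <- s) x *~ a x.
Proof.
move=> us ut st a0; rewrite (bigID (mem s)) /= [X in _ + X]big1 ?addr0; last first.
  by move=> x /a0 ->; rewrite mulr0z.
rewrite -big_filter; apply: perm_big; apply: uniq_perm => //.
  exact: filter_uniq.
by move=> x; rewrite mem_filter /=; case xs: (x \in s); rewrite //= st.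
Qed.

Section FreeCoordinates.
Variables (F : zmodType) (X : set F) (XF : zbasis X).

Lemma coordinatesB g h a b :
  coordinates X g a -> coordinates X h b ->
  coordinates X (g - h) (fun x => a x - b x).
Proof.
move=> [s [us sX sa ->]] [t [ut tX tb ->]].
have inst x : (x \in undup (s ++ t)) = (x \in s) || (x \in t).
  by rewrite mem_undup mem_cat.
exists (undup (s ++ t)); split.
- exact: undup_uniq.
- by move=> x /=; rewrite inst => /orP[/sX|/tX].
- by move=> x; rewrite inst negb_or => /andP[/sa -> /tb ->]; rewrite subr0.
rewrite -(@sum_widen _ s (undup (s ++ t))) ?undup_uniq //; last first.
  by move=> x xs; rewrite inst xs.
rewrite -(@sum_widen _ t (undup (s ++ t))) ?undup_uniq //; last first.
  by move=> x xt; rewrite inst xt orbT.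
by rewrite -sumrB; apply: eq_bigr => x _; rewrite mulrzBr.
Qed.

Lemma coordinates0 a : coordinates X 0 a -> forall x, a x = 0.
Proof.
move=> [s [us sX sa /esym s0]] x; have [xs|/sa//] := boolP (x \in s).
exact: (proj2 XF) s0 x xs.
Qed.

Lemma coordinates_basis x : X x -> coordinates X x (fun y => (y == x)%:Z).
Proof.
move=> Xx; exists [:: x]; split=> //.
- by move=> y /=; rewrite inE => /eqP ->.
- by move=> y; rewrite inE => /negPf ->.
by rewrite big_seq1 eqxx mulr1z.
Qed.

Lemma coordinates_exist g : exists a, coordinates X g a.
Proof.
have [s [e [sX ->]]] := proj1 XF g; elim: s sX => [|y s IHs] sX.
  exists (fun=> 0), [::]; split=> //; by rewrite !big_nil.
have [|a aP] := IHs; first by move=> x /= xs; apply: sX; rewrite /= inE xs orbT.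
have Xy : X y by apply: sX; rewrite /= mem_head.
have yz k : exists b, coordinates X (y *~ k) b.
  have [t [ut tX ta yE]] := coordinates_basis Xy.
  exists (fun x => (x == y)%:Z * k), t; split=> //; first by move=> x /ta ->; rewrite mul0r.
  by rewrite {1}yE mulrz_suml; apply: eq_bigr => x _; rewrite mulrzA.
(* The new term is added by subtracting its opposite, to reuse [coordinatesB]. *)
have [b bP] := yz (- e y).
exists (fun x => a x - b x); rewrite big_cons.
by have := coordinatesB aP bP; rewrite mulrNz opprK addrC.
Qed.

Lemma separating_coordinate g :
  g <> 0 -> exists x (phi : {additive F -> int}), phi x = 1 /\ phi g <> 0.
Proof.
move=> g0; have /choice[a aP] := coordinates_exist.
have aB x : {morph a^~ x : g h / g - h}.
  move=> u v; have := coordinatesB (coordinatesB (aP u) (aP v)) (aP (u - v)).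
  by rewrite subrr => /coordinates0/(_ x)/eqP; rewrite subr_eq0 => /eqP <-.
have [x [Xx ax]] : exists x, X x /\ a g x <> 0.
  apply: contrapT => noax; apply: g0; have [s [us sX sa gE]] := aP g.
  rewrite gE big1_seq // => x /= xs; have [->|/eqP ax] := eqVneq (a g x) 0.
    by rewrite mulr0z.
  by case: noax; exists x; split=> //; apply: sX.
exists x, (pack_additive (aB x)); split=> //=.
have := coordinatesB (aP x) (coordinates_basis Xx).
by rewrite subrr => /coordinates0/(_ x)/eqP; rewrite eqxx subr_eq0 => /eqP.
Qed.

End FreeCoordinates.

(** If c is nonzero, a coordinate of c maps [H] onto some nZ with n nonzero. An element [h0] over n
    spans an infinite cyclic summand of [H], matched with the summand <x> of [F]. *)
Lemma free_pair_zero (F H : zmodType) (X : set F) (c : {additive H -> F}) :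
  zbasis X -> no_common_idempotent H F -> forall h, c h = 0.
Proof.
move=> XF NC h; apply: contrapT => ch.
have [x [phi [phix phich]]] := separating_coordinate XF ch.
pose psi : {additive H -> int} := phi \o c.
have [n nP] : exists n : nat, forall k : int, range psi k <-> (n %| k)%Z.
  have psub : zsubgroup (range psi).
    split=> [|_ _ [u _ <-] [v _ <-]]; first by exists 0; rewrite ?raddf0.
    by exists (u - v); rewrite ?raddfB.
  have [n nP] := order_mod psub 1; exists n => k; rewrite -nP.
  by rewrite -[1 *~ k]/(k%:~R) intz.
have n0 : n%:Z != 0.
  apply/eqP => n0; have : range psi (psi h) by exists h.
  by move=> /nP; rewrite n0 dvd0z => /eqP.
have [h0 _ h0n] : range psi n by apply/nP; rewrite dvdzz.
have dvd y : (n %| psi y)%Z by apply/nP; exists y.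
have cB : {morph (fun y => x *~ (psi y %/ n)%Z) : y z / y - z}.
  move=> y z; rewrite -mulrzBr; congr (_ *~ _).
  by apply: (mulIf n0); rewrite mulrBl !divzK // raddfB.
have bB : {morph (fun f => h0 *~ phi f) : f g / f - g}.
  by move=> f g; rewrite raddfB mulrzBr.
have phixz k : phi (x *~ k) = k.
  by rewrite (raddfMz phi) phix -[1 *~ k]/(k%:~R) intz.
pose q y := (psi y %/ n)%Z.
have qh0 k : q (h0 *~ k) = k.
  by rewrite /q (raddfMz psi) h0n -[n%:Z *~ _]mulrzr intz mulrC mulzK.
have idem y : h0 *~ phi (x *~ q (h0 *~ phi (x *~ q y))) = h0 *~ phi (x *~ q y).
  by rewrite !phixz qh0.
have := NC (pack_additive bB) (pack_additive cB) idem h0.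
rewrite -[LHS]/(h0 *~ phi (x *~ q h0)) phixz /q h0n divzz n0 mulr1z => h00.
by move: n0; rewrite -h0n h00 raddf0.
Qed.

(** In blocks, [c \o b] has zero F-row, zero D-to-D and D-to-B entries and a nilpotent B-to-B entry:
    one step removes F, n more remove B, and a last one removes D. *)
Lemma divisible_bounded_free_nilpotent (D B F H : zmodType) (N : nat) (X : set F)
    (b : {additive (D * B * F)%type -> H}) (c : {additive H -> (D * B * F)%type}) :
  zdivisible [set: D] -> (0 < N)%N -> (forall x : B, x *+ N = 0) -> zbasis X ->
  no_common_idempotent H (D * B * F)%type ->
  exists n, forall x, iter n (c \o b) x = 0.
Proof.
move=> Ddiv N_gt0 BN XF NC.
have iDB : {morph (fun d : D => (d, 0, 0) : D * B * F) : x y / x - y}.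
  by move=> x y; congr (_, _, _); rewrite /= subr0.
have iBB : {morph (fun d : B => (0, d, 0) : D * B * F) : x y / x - y}.
  by move=> x y; congr (_, _, _); rewrite /= subr0.
have iFB : {morph (fun d : F => (0, 0, d) : D * B * F) : x y / x - y}.
  by move=> x y; congr (_, _, _); rewrite /= subr0.
pose iD := pack_additive iDB; pose iB := pack_additive iBB; pose iF := pack_additive iFB.
pose pD : {additive (D * B * F)%type -> D} := fst \o fst.
pose pB : {additive (D * B * F)%type -> B} := snd \o fst.
pose pF : {additive (D * B * F)%type -> F} := snd.
have retract (E : zmodType) (i : {additive E -> (D * B * F)%type})
    (p : {additive (D * B * F)%type -> E}) :
    cancel i p -> no_common_idempotent H E.
  move=> ip b' c' idem x.
  have := NC (b' \o p) (i \o c') _ x; rewrite /= ip; apply=> y.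
  by rewrite !ip.
have cF := free_pair_zero (pF \o c) XF (retract _ iF pF (fun=> erefl)).
have cD := divisible_pair_zero (b \o iD) (pD \o c) Ddiv (retract _ iD pD (fun=> erefl)).
have [n cB] := bounded_nilpotent (b \o iB) (pB \o c) N_gt0 BN (retract _ iB pB (fun=> erefl)).
(* Elements of [D] are divisible by N, which kills [B]. *)
have cDB d : pB (c (b (iD d))) = 0.
  have [d' _ <-] := Ddiv N d N_gt0 I.
  by rewrite (raddfMn iD) !raddfMn BN.
pose g : {additive (D * B * F)%type -> (D * B * F)%type} := c \o b.
have split3 x : x = iD (pD x) + iB (pB x) + iF (pF x).
  by case: x => [[d e] f]; congr (_, _, _); rewrite /= ?(addr0, add0r).
have gF x : pF (g x) = 0 by exact: cF.
have gB x : pF x = 0 -> pB (g x) = ((pB \o c) \o (b \o iB)) (pB x).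
  move=> x0; rewrite {1}(split3 x) x0 (raddf0 iF) addr0 raddfD.
  by rewrite (raddfD pB) [X in X + _]cDB add0r.
have gnB m x : pB (iter m g (g x)) = iter m ((pB \o c) \o (b \o iB)) (pB (g x)).
  elim: m => // m IHm; rewrite 2!iterS gB ?IHm //.
  by case: (m) => [|m']; rewrite ?iterS; exact: gF.
exists n.+2 => x; rewrite iterS iterSr.
set y := iter n _ _.
have yB : pB y = 0 by rewrite /y (gnB n) cB.
have yF : pF y = 0 by rewrite /y; case: (n) => [|m]; exact: gF.
rewrite (split3 (_ y)) -/g [pF _]gF raddf0 addr0.
rewrite [pB _](gB y yF) yB raddf0 raddf0 addr0.
by rewrite (split3 y) yB yF !raddf0 !addr0 [pD _]cD raddf0.
Qed.

End AdditiveGroups.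

(** * Normal endomorphisms and direct factors *)

Section Homs.
Variables (G L : groupType) (f : {multiplicative G -> L}).

Lemma hom1 : f 1 = 1.
Proof. by apply: (@mulgI _ (f 1)); rewrite -gmulfM !mulg1. Qed.

Lemma homV x : f x^-1 = (f x)^-1.
Proof. by apply: (@mulgI _ (f x)); rewrite -gmulfM !mulgV hom1. Qed.

Lemma homF x y : f (x / y) = f x / f y.
Proof. by rewrite gmulfM homV. Qed.

Lemma homJ x y : f (x ^ y) = f x ^ f y.
Proof. by rewrite !conjgE !gmulfM homV. Qed.

Lemma hom_inj : (forall x, f x = 1 -> x = 1) -> injective f.
Proof.
move=> f1 x y fxy; apply/eqP; rewrite -divg_eq1; apply/eqP/f1.
by rewrite homF fxy divgg.
Qed.

End Homs.

Definition pack_multiplicative (G L : groupType) (f : G -> L)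
    (fM : {morph f : x y / x * y}) : {multiplicative G -> L} :=
  HB.pack f (isMultiplicative.Build G L f fM).

Definition normal_endo (G : groupType) (f : G -> G) : Prop :=
  forall x g : G, f (x ^ g) = f x ^ g.

Lemma normal_endo_iter (G : groupType) (f : G -> G) n :
  normal_endo f -> normal_endo (iter n f).
Proof. by move=> fJ x g; elim: n => //= n ->; rewrite fJ. Qed.

Lemma morph_iter (G : groupType) (f : {multiplicative G -> G}) n :
  {morph iter n f : x y / x * y}.
Proof. by move=> x y; elim: n => //= n ->; rewrite gmulfM. Qed.

Lemma iter_mul1 (G : groupType) (f : {multiplicative G -> G}) n :
  iter n f 1 = 1.
Proof. by elim: n => //= n ->; rewrite hom1. Qed.

Lemma range_normal (G : groupType) (f : {multiplicative G -> G}) :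
  normal_endo f -> normal_subgroup (range f).
Proof.
move=> fJ; split; first split.
- by exists 1; rewrite ?hom1.
- by move=> _ _ [x _ <-] [y _ <-]; exists (x * y); rewrite ?gmulfM.
- by move=> _ [x _ <-]; exists x^-1; rewrite ?homV.
- by move=> _ g [x _ <-]; exists (x ^ g); rewrite ?fJ.
Qed.

Lemma kernel_normal (G L : groupType) (f : {multiplicative G -> L}) :
  normal_subgroup [set x | f x = 1].
Proof.
split; first split => /=.
- by rewrite hom1.
- by move=> x y; rewrite gmulfM => -> ->; rewrite mulg1.
- by move=> x; rewrite homV => ->; rewrite invg1.
- by move=> x g /= fx; rewrite homJ fx conj1g.
Qed.

(** * Fitting's lemma and stable iterates *)

Lemma fitting_direct_factor (G : groupType) (f : {multiplicative G -> G}) :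
  normal_endo f -> (forall x, f (f x) = 1 -> f x = 1) ->
  (forall x, exists y, f x = f (f y)) -> direct_factor (range f).
Proof.
move=> fJ fker fim; split; first exact: range_normal.
exists [set x | f x = 1]; split; first exact: kernel_normal.
  rewrite eqEsubset; split=> [_ [[x _ <-]] /= /fker //|_ ->].
  by split; [exists 1|]; rewrite /= ?hom1.
move=> g; have [y fg] := fim g.
exists (f y), ((f y)^-1 * g); split; first by exists y.
  by rewrite /= gmulfM homV fg mulVg.
by rewrite mulVKg.
Qed.

(** With f = [b \o c] stable, [H] is the product of im f and ker f, and [c] maps im f isomorphically
    onto the image of the square of [c \o b]. *)
Lemma fitting_common_factor (H K : groupType) (b : {multiplicative K -> H})
    (c : {multiplicative H -> K}) :
  normal_endo (b \o c) -> normal_endo (c \o b) ->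
  (forall x, b (c (b (c x))) = 1 -> b (c x) = 1) ->
  (forall x, exists y, b (c x) = b (c (b (c y)))) ->
  ~ common_nontrivial_direct_factor H K -> forall x, b (c x) = 1.
Proof.
move=> fJ gJ fker fim nHK x0; apply: contrapT => fx0; apply: nHK.
(* The square is needed: stability of [b \o c] passes to [c \o b] only up to one extra
   application. *)
pose g2 : {multiplicative K -> K} := (c \o b) \o (c \o b).
exists (range (b \o c)), (range g2); split.
- exact: (@fitting_direct_factor _ (b \o c)).
- move=> eqf; apply: fx0; have : range (b \o c) (b (c x0)) by exists x0.
  by rewrite eqf.
- apply: fitting_direct_factor => [x y|x /= gx|k] /=.
  + by have := gJ (c (b x)) y; rewrite /= => <-; have /= -> := gJ x y.
  + have : b (c (b (c (b (c (b x)))))) = 1.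
      by apply: fker; rewrite gx hom1.
    by move=> /fker/fker ->; rewrite hom1.
  + have [y1 e1] := fim (b k); have [y2 e2] := fim y1; have [y3 e3] := fim y2.
    by exists (c y3); rewrite e1 e2 e3.
exists c; split; first by move=> *; rewrite gmulfM.
split.
- move=> _ [x _ <-]; have [y e1] := fim x.
  by exists (c y); rewrite //= e1.
- move=> _ _ /set_mem[x _ <-] /set_mem[y _ <-] /= exy.
  apply/eqP; rewrite -divg_eq1 -!homF; apply/eqP/fker.
  by rewrite !homF exy divgg.
- by move=> _ [k _ <-]; exists (b (c (b k))).
Qed.

(** This says that the n-th iterate satisfies the hypotheses of Fitting's lemma. *)
Definition stable_iter (G : groupType) (f : G -> G) n : Prop :=
  (forall x, iter (n + n) f x = 1 -> iter n f x = 1) /\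
  (forall x, exists y, iter n f x = iter (n + n) f y).

Definition nilpotent_endo (G : groupType) (f : G -> G) : Prop :=
  exists n, forall x, iter n f x = 1.

Lemma iter_comp_swap (T U : Type) (b : U -> T) (c : T -> U) n x :
  c (iter n (b \o c) x) = iter n (c \o b) (c x).
Proof. by elim: n => //= n ->. Qed.

Lemma nilpotent_swap (H K : groupType) (b : {multiplicative K -> H})
    (c : {multiplicative H -> K}) :
  nilpotent_endo (b \o c) -> nilpotent_endo (c \o b).
Proof.
move=> [n nil]; exists n.+1 => x.
by rewrite iterSr /= -iter_comp_swap nil hom1.
Qed.

(** Fitting's lemma is applied to [b] and c(bc)^n, whose composites are the (n+1)-st iterates of
    [b \o c] and [c \o b]. *)
Lemma stable_nilpotent (H K : groupType) (b : {multiplicative K -> H})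
    (c : {multiplicative H -> K}) n :
  normal_endo (b \o c) -> normal_endo (c \o b) ->
  ~ common_nontrivial_direct_factor H K ->
  stable_iter (b \o c) n.+1 -> nilpotent_endo (b \o c).
Proof.
move=> fJ gJ nHK [kst ist]; exists n.+1.
pose cn : {multiplicative H -> K} := c \o pack_multiplicative (morph_iter (b \o c) n).
have bcE x : b (cn x) = iter n.+1 (b \o c) x by [].
have cbE : cn \o b = iter n.+1 (c \o b).
  by apply/funext => k; rewrite iterSr /= iter_comp_swap.
move=> x; rewrite -bcE; apply: fitting_common_factor nHK _ => //.
- exact: (@normal_endo_iter _ (b \o c) n.+1).
- by rewrite cbE; exact: (@normal_endo_iter _ (c \o b)).
- by move=> y; rewrite !bcE -iterD; apply: kst.
- by move=> y; have [z] := ist y; exists z; rewrite !bcE -iterD.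
Qed.

Lemma chain_conditions_stable (G : groupType) (f : {multiplicative G -> G}) :
  max_condition_normal G -> min_condition_normal G -> normal_endo f ->
  exists n, stable_iter f n.+1.
Proof.
move=> Gmax Gmin fJ.
pose fn n := pack_multiplicative (morph_iter f n).
have [_ [n1 _ <-] maxn1] : exists2 N,
    range (fun n => [set x | fn n x = 1]) N &
    forall M, range (fun n => [set x | fn n x = 1]) M -> N `<=` M -> M = N.
  apply: Gmax; last by exists [set x | fn 0 x = 1], 0.
  by move=> _ [n _ <-]; apply: (kernel_normal (fn n)).
have [_ [n2 _ <-] minn2] : exists2 N,
    range (fun n => range (fn n)) N &
    forall M, range (fun n => range (fn n)) M -> M `<=` N -> M = N.
  apply: Gmin; last by exists (range (fn 0)), 0.
  by move=> _ [n _ <-]; apply: range_normal; exact: (normal_endo_iter n fJ).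
have ker_eq m x : iter (m + n1) f x = 1 -> iter n1 f x = 1.
  move=> fx; have eqk : [set x | fn (m + n1) x = 1] = [set x | fn n1 x = 1].
    apply: maxn1 => [|y /=]; first by exists (m + n1).
    by rewrite iterD => ->; rewrite iter_mul1.
  by have : [set x | fn (m + n1) x = 1] x by []; rewrite eqk.
have im_eq m x : exists y, iter n2 f x = iter (m + n2) f y.
  have : range (fn n2) (fn n2 x) by exists x.
  have <- : range (fn (m + n2)) = range (fn n2).
    apply: minn2 => [|_ [y _ <-]]; first by exists (m + n2).
    by exists (iter m f y); rewrite //= -iterD addnC.
  by move=> [y _ fy]; exists y; exact: esym fy.
pose n := (n1 + n2).+1.
have e1 : n = (n2.+1 + n1)%N by rewrite addSn addnC.
have e2 : n = (n1.+1 + n2)%N by rewrite addSn.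
exists (n1 + n2); rewrite -/n; split=> x.
  rewrite {2}e1 addnA => /ker_eq fx.
  by rewrite e1 iterD fx iter_mul1.
have [y fy] := im_eq n x; exists y.
have -> : (n + n = n1.+1 + (n + n2))%N by rewrite {1}e2 -addnA (addnC n2).
by rewrite e2 iterD fy -iterD -e2.
Qed.

(** A central image is abelian, so commutators are killed. *)
Lemma derived_subgroup_central_kernel (G L : groupType)
    (f : {multiplicative G -> L}) x :
  (forall y, center L (f y)) -> derived_subgroup G x -> f x = 1.
Proof.
move=> fZ; apply: (@smallest_sub _ _ _ [set x | f x = 1]) => [|_ [y [z ->]]].
  by have [] := kernel_normal f.
rewrite /= commgEl gmulfM homV homJ.
by rewrite conjgE (fZ y) mulKg mulVg.
Qed.

(* [e x = x * (f x)^-1] is a second normal endomorphism commuting with [f], *)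
(* and [e \o f] is central, hence kills the derived subgroup, hence the     *)
(* centre: [e^2 f^2 = 1] with [e + f = 1], which splits off the image       *)
(* of [f^2].                                                                *)
Lemma stem_stable (G : groupType) (f : {multiplicative G -> G}) :
  stem_group G -> normal_endo f -> stable_iter f 2.
Proof.
move=> Gstem fJ.
pose e x := x / f x.
have efC x y : commute (e x) (f y).
  apply/commute_sym/commgP/conjg_fixP.
  by rewrite conjgM -fJ homJ -conjgM mulgV conjg1.
have eM : {morph e : x y / x * y}.
  move=> x y; have eyC := commuteV (efC y x).
  by rewrite [e x in RHS]/e -mulgA -eyC /e gmulfM invgM !mulgA.
pose ehom := pack_multiplicative eM.
have efE x : e (f x) = f (e x) by rewrite /e homF.
have eeE x : e x * f x = x by rewrite mulgVK.
have efZ x : center G (e (f x)).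
  move=> y; rewrite -(eeE y); apply: commuteM; last exact: efC.
  by rewrite efE; apply/commute_sym/efC.
have eeff x : e (e (f (f x))) = 1.
  rewrite (efE (f x)).
  exact: (@derived_subgroup_central_kernel _ _ (ehom \o f) _ efZ (Gstem _ (efZ x))).
split=> x /=.
  (* Additively: e y = e^2 y + e f y = f y, hence f y = e f y = e^2 y = 0, and y = e y + f y = 0. *)
  set y := f (f x) => ffy.
  have ey : e y * f y = y by [].
  have : e (e y) = 1 by apply: eeff.
  rewrite -[e (e y)]/(ehom (ehom y)) => ey1.
  have efy : e (f y) = f y by rewrite /e ffy invg1 mulg1.
  have := eM (e y) (f y); rewrite eeE efy -[e (e y)]/(ehom (ehom y)) ey1 mul1g => eyf.
  have : e (e y) = e (f y) by rewrite eyf.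
  by rewrite efy -[e (e y)]/(ehom (ehom y)) ey1 => fy; rewrite -ey eyf -fy mulg1.
(* Additively w = 1 + e, and 1 - e^2 = f(1 + e). *)
pose w x := e x * x.
have step z : e (e z) = 1 -> z = f (w z).
  move=> ez; rewrite /w gmulfM -[in LHS](eeE z) -[in LHS](eeE (e z)) ez.
  by rewrite mul1g.
exists (w (w x)).
have wf y : w (f y) = f (w y) by rewrite /w efE -gmulfM.
rewrite (step (f (f x))) // !wf; congr (f _).
by rewrite (step (f (f (w x)))) // !wf.
Qed.

(** * Matrices of automorphisms *)

Lemma nilpotent_fixed (G : groupType) (f : G -> G) x :
  nilpotent_endo f -> f x = x -> x = 1.
Proof. by move=> [n nil] fx; rewrite -(nil x); elim: n {nil} => //= n <-. Qed.

(** The solution is the geometric product y f(y) ... f^(n-1)(y). *)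
Lemma nilpotent_div_surj (G : groupType) (f : {multiplicative G -> G}) y :
  nilpotent_endo f -> exists x, x / f x = y.
Proof.
move=> [n nil]; pose s := fix s k := if k is k'.+1 then y * f (s k') else 1.
have sS k : s k.+1 = s k * iter k f y.
  elim: k => [|k IHk]; first by rewrite /= hom1 mulg1 mul1g.
  by rewrite -[LHS]/(y * f (s k.+1)) {1}IHk gmulfM mulgA.
by exists (s n); rewrite -{1}[s n]mulg1 -(nil y) -sS mulgK.
Qed.

Definition nilpotent_pairs (H K : groupType) : Prop :=
  forall (b : {multiplicative K -> H}) (c : {multiplicative H -> K}),
    normal_endo (b \o c) -> normal_endo (c \o b) -> nilpotent_endo (b \o c).

Lemma nilpotent_pairs_sym (H K : groupType) :
  nilpotent_pairs H K -> nilpotent_pairs K H.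
Proof. by move=> nil b c fJ gJ; apply/nilpotent_swap/nil. Qed.

(** Conjugation by g = e(g) f(g) acts on the image of [f] as conjugation by f(g). *)
Lemma split_normal_endo (G : groupType) (e f : {multiplicative G -> G}) :
  (forall x, e x * f x = x) -> (forall x y, commute (e x) (f y)) ->
  normal_endo f.
Proof.
move=> ef efC x g; rewrite homJ -[in RHS](ef g) conjgM.
by congr (_ ^ _); apply/esym/conjg_fixP/commgP/commute_sym/efC.
Qed.

Definition swap_matrix (H K : groupType) (M : hom_matrix H K) :
    hom_matrix K H :=
  HomMatrix (hm_delta M) (hm_gamma M) (hm_beta M) (hm_alpha M).

Lemma hom_matrix_commute (H K : groupType) (M : hom_matrix H K) h k :
  {morph hom_matrix_fun M : x y / x * y} ->
  commute (hm_alpha M h) (hm_beta M k) /\ commute (hm_gamma M h) (hm_delta M k).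
Proof.
move=> Mmorph; have := Mmorph (1, k) (h, 1).
rewrite /hom_matrix_fun /= => -[].
rewrite !hom1 !(mulg1, mul1g) => e1 e2.
by split; rewrite /commute ?e1 ?e2.
Qed.

Lemma swap_matrix_fun (H K : groupType) (M : hom_matrix H K) :
  {morph hom_matrix_fun M : x y / x * y} ->
  hom_matrix_fun (swap_matrix M) =
  (fun x => (x.2, x.1)) \o hom_matrix_fun M \o (fun x => (x.2, x.1)).
Proof.
move=> Mmorph; apply/funext => -[k h]; rewrite /hom_matrix_fun /=.
by have [-> ->] := hom_matrix_commute h k Mmorph.
Qed.

(** The products of the two matrices give alpha alpha' + beta gamma' = 1 and gamma' beta + delta'
    delta = 1, so beta gamma' is normal and nilpotent. Thus alpha is onto and alpha' injective;
    exchanging the matrices gives the rest. Finally beta is central because its image commutes with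
    im alpha = H. *)
Lemma inverse_matrices_row (H K : groupType) (M N : hom_matrix H K) :
  nilpotent_pairs H K ->
  {morph hom_matrix_fun M : x y / x * y} ->
  {morph hom_matrix_fun N : x y / x * y} ->
  cancel (hom_matrix_fun M) (hom_matrix_fun N) ->
  cancel (hom_matrix_fun N) (hom_matrix_fun M) ->
  bijective (hm_alpha M) /\ range (hm_beta M) `<=` center H.
Proof.
move=> nil.
have key (P Q : hom_matrix H K) :
    {morph hom_matrix_fun P : x y / x * y} ->
    {morph hom_matrix_fun Q : x y / x * y} ->
    cancel (hom_matrix_fun P) (hom_matrix_fun Q) ->
    cancel (hom_matrix_fun Q) (hom_matrix_fun P) ->
    (forall y, exists x, hm_alpha P x = y) /\ injective (hm_alpha Q).
  move=> Pmorph Qmorph PK QK.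
  pose f : {multiplicative H -> H} := hm_beta P \o hm_gamma Q.
  pose e : {multiplicative H -> H} := hm_alpha P \o hm_alpha Q.
  have ef x : e x * f x = x.
    have := QK (x, 1); rewrite /hom_matrix_fun /= !hom1 !mulg1.
    by case.
  have efC x y : commute (e x) (f y).
    by have [] := hom_matrix_commute (hm_alpha Q x) (hm_gamma Q y) Pmorph.
  have nf : nilpotent_endo f.
    apply: nil; first exact: split_normal_endo efC.
    apply: (@split_normal_endo _ (hm_delta Q \o hm_delta P)
                                 (hm_gamma Q \o hm_beta P)).
      move=> x; have := PK (1, x); rewrite /hom_matrix_fun /= !hom1 !mul1g.
      case=> _ eqx; rewrite -[RHS]eqx; apply/esym.
      by have [] := hom_matrix_commute (hm_beta P x) (hm_delta P x) Qmorph.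
    move=> x y; apply: commute_sym.
    by have [] := hom_matrix_commute (hm_beta P y) (hm_delta P x) Qmorph.
  split=> [y|].
    have [x <-] := nilpotent_div_surj y nf; exists (hm_alpha Q x).
    by rewrite -{2}(ef x) mulgK.
  apply: hom_inj => x ax; apply: (nilpotent_fixed nf).
  by rewrite -[RHS]ef /e /= ax hom1 mul1g.
move=> Mmorph Nmorph MK NK.
have [asurj _] := key M N Mmorph Nmorph MK NK.
have [_ ainj] := key N M Nmorph Mmorph NK MK.
split=> [|_ [k _ <-] h].
  rewrite -setTT_bijective; split=> //.
    by move=> x y _ _; apply: ainj.
  by move=> y _; have [x <-] := asurj y; exists x.
have [x <-] := asurj h; apply: commute_sym.
by have [] := hom_matrix_commute x k Mmorph.
Qed.

Lemma Aut_prod_sub_calA (H K : groupType) :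
  nilpotent_pairs H K ->
  Aut (H * K)%type `<=` [set hom_matrix_fun M | M in calA H K].
Proof.
move=> nil phi [phiM [psi phiK psiK]].
have psiM : {morph psi : x y / x * y}.
  exact: (@can2_gmulfM _ _ (pack_multiplicative phiM) psi phiK psiK).
have [M eM] := endo_hom_matrix phiM; have [N eN] := endo_hom_matrix psiM.
subst phi psi; exists M => //.
have [abij bZ] := inverse_matrices_row nil phiM psiM phiK psiK.
have [||||dbij cZ] := @inverse_matrices_row _ _ (swap_matrix M) (swap_matrix N)
    (nilpotent_pairs_sym nil); rewrite ?swap_matrix_fun //.
- by move=> x y; exact: (congr1 (fun z : H * K => (z.2, z.1)) (phiM (x.2, x.1) (y.2, y.1))).
- by move=> x y; exact: (congr1 (fun z : H * K => (z.2, z.1)) (psiM (x.2, x.1) (y.2, y.1))).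
- by move=> [k h]; rewrite /comp -surjective_pairing phiK.
- by move=> [k h]; rewrite /comp -surjective_pairing psiK.
Qed.

(** Put b = alpha^-1 beta and c = delta^-1 gamma, both central. Eliminating the K-coordinate reduces
    injectivity and surjectivity to 1 - bc. *)
Lemma calA_sub_Aut_prod (H K : groupType) :
  nilpotent_pairs H K ->
  [set hom_matrix_fun M | M in calA H K] `<=` Aut (H * K)%type.
Proof.
move=> nil _ [M [[a' aK a'K] [d' dK d'K] bZ cZ] <-].
have bC k x : commute (hm_beta M k) x by apply: bZ; exists k.
have cC h x : commute (hm_gamma M h) x by apply: cZ; exists h.
have Mmorph : {morph hom_matrix_fun M : x y / x * y}.
  move=> [h1 k1] [h2 k2]; rewrite /hom_matrix_fun /= !gmulfM.
  congr (_, _).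
    by rewrite -!mulgA; congr (_ * _); rewrite !mulgA (bC k1).
  by rewrite -!mulgA; congr (_ * _); rewrite !mulgA (cC h2).
pose a'h := pack_multiplicative (can2_gmulfM aK a'K).
pose d'h := pack_multiplicative (can2_gmulfM dK d'K).
pose b : {multiplicative K -> H} := a'h \o hm_beta M.
pose c : {multiplicative H -> K} := d'h \o hm_gamma M.
have b'C k x : commute (b k) x.
  by rewrite /b /= -(aK x); apply: (@gmulf_commute _ _ a'h); apply: bC.
have c'C h x : commute (c h) x.
  by rewrite /c /= -(dK x); apply: (@gmulf_commute _ _ d'h); apply: cC.
have conj_central (G : groupType) (z g : G) : (forall x, commute z x) -> z ^ g = z.
  by move=> zC; apply/conjg_fixP/commgP.
have nf : nilpotent_endo (b \o c).
  apply: nil => x g; rewrite [LHS]homJ.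
    by rewrite !(conj_central _ ((b \o c) x)) //; apply: b'C.
  by rewrite !(conj_central _ ((c \o b) x)) //; apply: c'C.
split=> //; rewrite -setTT_bijective; split=> //.
  move=> x y _ _; apply: (@hom_inj _ _ (pack_multiplicative Mmorph)) => {x y}.
  move=> [h k] /=; rewrite /hom_matrix_fun /= => -[e1 e2].
  have ek : k = (c h)^-1.
    by rewrite -[LHS]dK -(mulg1_eq e2); exact: (homV d'h).
  have h1 : h = 1.
    have ch : c h = k^-1 by rewrite ek invgK.
    apply: (nilpotent_fixed nf); rewrite -[LHS]/(b (c h)) ch (homV b).
    by rewrite -[LHS](homV a'h) -(mulg1_eq e1) invgK; exact: aK.
  by rewrite ek h1 hom1 invg1.
move=> [x y] _.
have [h eh] := nilpotent_div_surj (a'h x / b (d' y)) nf.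
exists (h, d' y / c h) => //; rewrite /hom_matrix_fun /=; congr (_, _).
  rewrite homF -[LHS]a'K -[RHS]a'K; congr (hm_alpha M _).
  rewrite -[LHS]/(a'h _) gmulfM homF -[a'h (hm_alpha M h)]/(a' _) aK.
  rewrite -[a'h (hm_beta M (d' y))]/(b (d' y)) -[a'h (hm_beta M (c h))]/(b (c h)).
  by rewrite b'C mulgA eh mulgVK.
by rewrite homF /c /= !d'K cC mulgVK.
Qed.

(** * The automorphism exchanging a common factor *)

Lemma direct_factor_projections (G : groupType) (A : set G) :
  direct_factor A ->
  exists p q : {multiplicative G -> G},
    [/\ forall x, p x * q x = x, forall x, A (p x),
        forall a, A a -> p a = a & forall a x, A a -> commute a (q x)].
Proof.
move=> [[[A1 AM AV] AJ] [B [[[B1 BM BV] BJ] AB ABG]]].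
have abC a b : A a -> B b -> commute a b.
  move=> Aa Bb; apply/commgP/eqP.
  suff : (A `&` B) [~ a, b] by rewrite AB.
  split; first by rewrite commgEl; apply: AM; [apply: AV|apply: AJ].
  by rewrite commgEr; apply: BM => //; apply/BJ/BV.
have abI a b a' b' : A a -> B b -> A a' -> B b' -> a * b = a' * b' ->
    a = a' /\ b = b'.
  move=> Aa Bb Aa' Bb' eab.
  have eq1 : a'^-1 * a = b' / b.
    by rewrite -(mulKg a' b') -eab mulgA mulgK.
  have : (A `&` B) (a'^-1 * a).
    by split; [apply: AM => //; apply: AV|rewrite eq1; apply: BM => //; apply: BV].
  rewrite AB => /= e; have aa' : a = a' by rewrite -(mulVKg a' a) e mulg1.
  by split=> //; apply: (@mulgI _ a); rewrite eab aa'.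
pose P x (u : G * G) := [/\ A u.1, B u.2 & x = u.1 * u.2].
have /choice[s sP] : forall x, exists u, P x u.
  by move=> x; have [a [b abx]] := ABG x; exists (a, b).
have sM x y : (s (x * y)).1 = (s x).1 * (s y).1 /\ (s (x * y)).2 = (s x).2 * (s y).2.
  have [Ax Bx ex] := sP x; have [Ay By ey] := sP y; have [Axy Bxy exy] := sP (x * y).
  apply: abI => //; [exact: AM|exact: BM|].
  rewrite -exy {1}ex {1}ey -!mulgA; congr (_ * _).
  by rewrite !mulgA; congr (_ * _); apply/commute_sym/abC.
have pM : {morph (fun x => (s x).1) : x y / x * y} by move=> x y; case: (sM x y).
have qM : {morph (fun x => (s x).2) : x y / x * y} by move=> x y; case: (sM x y).
exists (pack_multiplicative pM), (pack_multiplicative qM).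
split=> [x|x|a Aa|a x Aa] /=; first by case: (sP x).
- by case: (sP x).
- have [As Bs es] := sP a.
  by have [] := abI _ _ _ _ As Bs Aa B1; rewrite ?mulg1.
- by have [_ Bx _] := sP x; apply: abC.
Qed.

Lemma Aut_prod_no_common_factor (H K : groupType) :
  Aut_prod_is_calA H K -> ~ common_nontrivial_direct_factor H K.
Proof.
move=> AutE [A [B [Afac ntA Bfac [f [fM [fAB finj fsurj]]]]]].
have [p [q [pq pA pid qC]]] := direct_factor_projections Afac.
have [p' [q' [pq' pB pid' qC']]] := direct_factor_projections Bfac.
have [AM B1 BM] : [/\ forall x y, A x -> A y -> A (x * y), B 1 &
    forall x y, B x -> B y -> B (x * y)].
  by case: Afac => -[[_ AM _] _] _; case: Bfac => -[[B1 BM _] _] _.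
have q1 a : A a -> q a = 1.
  by move=> Aa; apply: (@mulgI _ a); rewrite mulg1 -{1}(pid a Aa) pq.
have q'1 b : B b -> q' b = 1.
  by move=> Bb; apply: (@mulgI _ b); rewrite mulg1 -{1}(pid' b Bb) pq'.
have p1 x : p (q x) = 1.
  by apply: (@mulgI _ (p x)); rewrite mulg1 -{1}(pid _ (pA x)) -gmulfM pq.
have p'1 x : p' (q' x) = 1.
  by apply: (@mulgI _ (p' x)); rewrite mulg1 -{1}(pid' _ (pB x)) -gmulfM pq'.
(* g is the projection [p'] onto B followed by the inverse of f. *)
have /choice[g gP] : forall k, exists a, A a /\ f a = p' k.
  by move=> k; have [a Aa fa] := fsurj _ (pB k); exists a.
have fI a a' : A a -> A a' -> f a = f a' -> a = a'.
  by move=> Aa Aa'; apply: finj; apply/mem_set.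
have FM : {morph (fun h => f (p h)) : x y / x * y}.
  by move=> x y; rewrite gmulfM fM.
have gM : {morph g : x y / x * y}.
  move=> x y; have [Ax fx] := gP x; have [Ay fy] := gP y; have [Axy fxy] := gP (x * y).
  by apply: fI => //; [exact: AM|rewrite fM // fx fy fxy gmulfM].
pose M := HomMatrix q (pack_multiplicative gM) (pack_multiplicative FM) q'.
have qid x : q (q x) = q x.
  by rewrite -[in RHS](pq x) gmulfM (q1 _ (pA x)) mul1g.
have q'id x : q' (q' x) = q' x.
  by rewrite -[in RHS](pq' x) gmulfM (q'1 _ (pB x)) mul1g.
have fB h : B (f (p h)) by apply: fAB; apply: pA.
have gf h : g (f (p h)) = p h.
  by have [Ag fg] := gP (f (p h)); apply: fI => //; rewrite fg pid'.
have gq k : g (q' k) = 1.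
  have g1 := hom1 (pack_multiplicative gM).
  have [Ag fg] := gP (q' k); have [A1 f1] := gP 1.
  by rewrite -[RHS]g1; apply: fI => //; rewrite fg f1 p'1 hom1.
have fg k : f (p (g k)) = p' k by have [Ag fg] := gP k; rewrite pid.
have MK : involutive (hom_matrix_fun M).
  move=> [h k]; rewrite /hom_matrix_fun /=; congr (_, _).
    have [Ag _] := gP k.
    rewrite gmulfM qid (q1 _ Ag) mulg1 gM gf gq mulg1 -[RHS]pq.
    exact/commute_sym/qC.
  have f1 : f 1 = 1 by rewrite -(hom1 p); exact: (hom1 (pack_multiplicative FM)).
  by rewrite (@gmulfM _ _ q') q'id (q'1 _ (fB h)) mul1g (FM (q h)) p1 fg f1 mul1g.
have Mmorph : {morph hom_matrix_fun M : x y / x * y}.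
  move=> [h1 k1] [h2 k2]; rewrite /hom_matrix_fun /= gM !gmulfM fM //.
  congr (_, _); rewrite -!mulgA; congr (_ * _); rewrite !mulgA; congr (_ * _).
    by apply/commute_sym/qC; case: (gP k1).
  exact/qC'.
have : Aut (H * K)%type (hom_matrix_fun M) by split=> //; exists (hom_matrix_fun M).
rewrite AutE => -[N [Nbij _ _ _] /hom_matrix_fun_inj[Nq _ _ _]].
apply: ntA; rewrite eqEsubset; split=> [a Aa|_ ->]; last by rewrite -(hom1 p).
by apply: (bij_inj Nbij); rewrite !Nq /= q1 ?hom1.
Qed.

(** * The three cases *)

(** A copy of G carrying the commutativity proof, on which the additive structure is convertible to
    the multiplicative one. *)
Definition additive_of (G : groupType) & abelian_group G : Type := G.

HB.instance Definition _ (G : groupType) (cG : abelian_group G) :=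
  Choice.on (additive_of cG).
HB.instance Definition _ (G : groupType) (cG : abelian_group G) :=
  GRing.isZmodule.Build (additive_of cG)
    (@mulgA G) cG (@mul1g G) (@mulVg G).

Lemma expgzE (G : groupType) (cG : abelian_group G) (x : G) (k : int) :
  expgz x k = ((x : additive_of cG) *~ k)%R.
Proof. by case: k. Qed.

Lemma abelian_basis_zbasis (G : groupType) (cG : abelian_group G) (X : set G) :
  abelian_basis X -> zbasis (X : set (additive_of cG)).
Proof.
move=> [gen ind].
have prodE (s : seq G) e :
    \prod_(x <- s) expgz x (e x) = (\sum_(x <- s) (x : additive_of cG) *~ e x)%R.
  elim: s => [|x s IHs]; first by rewrite !big_nil.
  by rewrite !big_cons IHs (expgzE cG).
split=> [g|s e us sX]; last by rewrite -prodE; apply: ind.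
by have [s [e [sX gE]]] := gen g; exists s, e; split; rewrite // gE prodE.
Qed.

(** The pair is transported along K = D + B + F into additive notation. [no_common_idempotent]
    follows from [fitting_common_factor], because idempotents are stable and all endomorphisms of
    abelian groups are normal. *)
Lemma abelian_nilpotent_pairs (H K : groupType) :
  abelian_group H -> abelian_group K -> divisible_bounded_free K ->
  ~ common_nontrivial_direct_factor H K -> nilpotent_pairs H K.
Proof.
move=> cH cK [D [B [F [[cD Ddiv] [cB [N N_gt0 BN]] [cF [X XF]] [u ubij]]]]] nHK b c _ _.
apply: nilpotent_swap; have [v uK vK] := ubij.
pose vh := pack_multiplicative (can2_gmulfM uK vK).
pose zD : zmodType := additive_of cD; pose zB : zmodType := additive_of cB.
pose zF : zmodType := additive_of cF; pose zH : zmodType := additive_of cH.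
have bB : {morph (b \o v : zD * zB * zF -> zH) : x y / (x - y)%R}.
  exact: (homF (b \o vh)).
have cB' : {morph (u \o c : zH -> zD * zB * zF) : x y / (x - y)%R}.
  exact: (homF (u \o c)).
have NC : no_common_idempotent zH (zD * zB * zF)%type.
  move=> b0 c0 idem.
  have b1M : {morph (b0 \o u : K -> H) : x y / x * y}.
    by move=> x y /=; rewrite gmulfM; apply: (GRing.raddfD b0).
  have c1M : {morph (v \o c0 : H -> K) : x y / x * y}.
    by move=> x y /=; rewrite -(gmulfM (s := vh)); congr (v _); apply: (GRing.raddfD c0).
  have abJ (G : groupType) (f : G -> G) : abelian_group G -> normal_endo f.
    move=> cG x g; have cJ z : z ^ g = z by apply/conjg_fixP/commgP/cG.
    by rewrite !cJ.
  have eqbc x : b0 (u (v (c0 x))) = b0 (c0 x) by rewrite vK.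
  have bc1 := @fitting_common_factor H K (pack_multiplicative b1M)
    (pack_multiplicative c1M) (abJ _ _ cH) (abJ _ _ cK).
  move=> x; rewrite -eqbc; apply: bc1 => // {}x /=.
    by rewrite !eqbc idem.
  by exists x; rewrite !eqbc idem.
have [|n nil] := divisible_bounded_free_nilpotent (pack_additive bB)
  (pack_additive cB') _ N_gt0 BN (abelian_basis_zbasis cF XF) NC.
  by move=> n x n_gt0 _; have [y yx] := Ddiv n x n_gt0; exists y.
exists n => k; rewrite -[LHS]uK.
have -> : u (iter n (c \o b) k) = iter n ((u \o c) \o (b \o v)) (u k).
  by elim: n {nil} => //= n <-; rewrite uK.
have -> : iter n ((u \o c) \o (b \o v)) (u k) = 1 := nil (u k).
exact: (hom1 vh).
Qed.

Lemma common_nontrivial_direct_factor_sym (H K : groupType) :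
  common_nontrivial_direct_factor H K -> common_nontrivial_direct_factor K H.
Proof.
move=> [A [B [Afac ntA Bfac [f [fM [fAB finj fsurj]]]]]].
have [[[A1 AM AV] _] _] := Afac; have [[[B1 BM BV] _] _] := Bfac.
have fI a a' : A a -> A a' -> f a = f a' -> a = a'.
  by move=> Aa Aa'; apply: finj; apply/mem_set.
have f1 : f 1 = 1 by apply: (@mulgI _ (f 1)); rewrite -fM // !mulg1.
have /choice[g gP] : forall b, exists a, B b -> A a /\ f a = b.
  (* Outside B the inverse takes the dummy value 1. *)
  move=> b; have [Bb|nBb] := pselect (B b); last by exists 1.
  by have [a Aa fa] := fsurj b Bb; exists a.
exists B, A; split=> //.
  move=> Bt; apply: ntA; rewrite eqEsubset; split=> [a Aa|_ -> //] /=.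
  by apply: fI => //; rewrite f1; have := fAB a Aa; rewrite Bt.
exists g; split=> [x y Bx By|].
  have [Ax fx] := gP x Bx; have [Ay fy] := gP y By.
  have [Axy fxy] := gP _ (BM _ _ Bx By).
  by apply: fI => //; [exact: AM|rewrite fM // fx fy].
split=> [b Bb|b b' /set_mem Bb /set_mem Bb' gbb'|a Aa].
- by case: (gP b Bb).
- by have [_ <-] := gP b Bb; have [_ <-] := gP b' Bb'; rewrite gbb'.
- exists (f a); first exact: fAB.
  by have [Ag fg] := gP _ (fAB a Aa); apply: fI.
Qed.

Lemma chain_conditions_nilpotent_pairs (H K : groupType) :
  max_condition_normal H -> min_condition_normal H ->
  ~ common_nontrivial_direct_factor H K -> nilpotent_pairs H K.
Proof.
move=> Hmax Hmin nHK b c fJ gJ.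
by have [n] := chain_conditions_stable Hmax Hmin fJ; apply: stable_nilpotent.
Qed.

Lemma stem_nilpotent_pairs (H K : groupType) :
  stem_group H -> ~ common_nontrivial_direct_factor H K -> nilpotent_pairs H K.
Proof.
move=> Hstem nHK b c fJ gJ.
exact: stable_nilpotent (stem_stable Hstem fJ).
Qed.

Theorem theoremD (H K : groupType)
  (hHK :
     ((max_condition_normal H /\ min_condition_normal H) /\
      (max_condition_normal K /\ min_condition_normal K))
     \/
     ((abelian_group H /\ abelian_group K) /\
      (divisible_bounded_free H \/ divisible_bounded_free K))
     \/
     (stem_group H \/ stem_group K)) :
  Aut_prod_is_calA H K <-> ~ common_nontrivial_direct_factor H K.
Proof.
split=> [|nHK]; first exact: Aut_prod_no_common_factor.
have nKH : ~ common_nontrivial_direct_factor K H.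
  by move=> /common_nontrivial_direct_factor_sym.
suff nil : nilpotent_pairs H K.
  by rewrite /Aut_prod_is_calA eqEsubset; split;
    [exact: Aut_prod_sub_calA|exact: calA_sub_Aut_prod].
case: hHK => [[[Hmax Hmin] _]|[[[cH cK] [Hdbf|Kdbf]]|[Hstem|Kstem]]].
- exact: chain_conditions_nilpotent_pairs.
- exact/nilpotent_pairs_sym/abelian_nilpotent_pairs.
- exact: abelian_nilpotent_pairs.
- exact: stem_nilpotent_pairs.
- exact/nilpotent_pairs_sym/stem_nilpotent_pairs.
Qed.
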